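(* Let $X$ be a topological space and $\mathcal{A}\subseteq \mathrm{Spec}(C(X))$. Then $\mathcal{A}$ has the P.A-property for finitely generated ideals of $C(X)$. Consequently, $\mathcal{A}$ has the P.A-property if and only if $\mathcal{A}$ is compact. In particular, if $A$ is a subset of $X$ satisfying at least one of the following conditions: (1) $X$ is compact and $A$ is a closed subset of $X$; (2) $A$ is a compact subset of $X$; then $\mathcal{M}_A=\{M_a\mid a\in A\}$ has the P.A-property for $C(X)$.
   Context: $C(X)$ denotes the ring of all continuous real-valued functions on $X$, and for $x\in X$, $M_x=\{f\in C(X)\mid f(x)=0\}$, a maximal ideal of $C(X)$. All rings are commutative with $1\neq 0$. For a ring $R$, a set $\mathcal{A}\subseteq \mathrm{Spec}(R)$ has the P.A-property (prime avoidance property) for $R$ if whenever an ideal $I$ of $R$ satisfies $I\subseteq\bigcup_{P\in\mathcal{A}}P$, there exists $P\in\mathcal{A}$ with $I\subseteq P$; it has the P.A-property for finitely generated ideals if this holds for every finitely generated ideal $I$. $\mathcal{A}$ carries the subspace topology of the Zariski topology on $\mathrm{Spec}(R)$; compact means every open cover has a finite subcover. *)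

(* Defs.v *)
From HB Require Import structures.
From mathcomp Require Import all_boot all_order all_algebra.
From mathcomp Require Import all_classical all_reals all_analysis.
Set Implicit Arguments.
Unset Strict Implicit.
Unset Printing Implicit Defensive.
Import Order.TTheory GRing.Theory Num.Theory.
Import numFieldNormedType.Exports.
Local Open Scope classical_set_scope.
Local Open Scope ring_scope.

(* The ideals and prime ideals of the library (ring_quotient) are all proper
   and live over nonzero rings; the ones below also allow the unit ideal, and
   the zero ring (which is C(X) for X empty, with empty spectrum). *)
Definition is_ideal (A : comPzRingType) (I : set A) : Prop :=
  [/\ I 0, (forall f g, I f -> I g -> I (f + g))
    & (forall a f, I f -> I (a * f))].

Definition is_prime_ideal (A : comPzRingType) (P : set A) : Prop :=
  [/\ is_ideal P, ~ P 1 & forall f g, P (f * g) -> P f \/ P g].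

Definition finitely_generated (A : comPzRingType) (I : set A) : Prop :=
  exists (n : nat) (g : 'I_n -> A),
    I = [set f | exists a : 'I_n -> A, f = \sum_(i < n) a i * g i].

Record Spec (A : comPzRingType) := MkSpec {
  prime_set :> set A;
  prime_setP : is_prime_ideal prime_set
}.

HB.instance Definition _ (A : comPzRingType) := gen_eqMixin (Spec A).
HB.instance Definition _ (A : comPzRingType) := gen_choiceMixin (Spec A).

Section Zariski.
Variable A : comPzRingType.
Implicit Types (E : set A) (P : Spec A).

Definition zariski_closed E : set (Spec A) := [set P | E `<=` P].

Definition zariski_open : set_system (Spec A) :=
  [set U | exists E, U = ~` zariski_closed E].

Lemma zariski_openT : zariski_open setT.
Proof.
exists [set 1]; apply/seteqP; split=> // P _ /(_ 1 erefl).
by case: (prime_setP P).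
Qed.

Lemma zariski_openI : setI_closed zariski_open.
Proof.
move=> _ _ [E ->] [F ->].
exists [set h | exists f g, [/\ E f, F g & h = f * g]].
apply/seteqP; split=> P /=.
  move=> [nE nF] EF; apply: nE => f Ef; apply: contrapT => nPf.
  apply: nF => g Fg; have [_ _ prP] := prime_setP P.
  by case: (prP f g) => //; apply: EF; exists f, g.
have [[_ _ idP] _ _] := prime_setP P.
move=> nEF; split=> EP; apply: nEF => _ [f [g [Ef Fg ->]]].
  by rewrite mulrC; apply/idP/EP.
by apply/idP/EP.
Qed.

Lemma zariski_open_bigU (J : Type) (U : J -> set (Spec A)) :
  (forall j, zariski_open (U j)) -> zariski_open (\bigcup_j U j).
Proof.
move=> /choice[E UE]; exists (\bigcup_j E j); apply/seteqP; split=> P /=.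
  by move=> [j _]; rewrite UE => nE EP; apply: nE => f Ef; apply: EP; exists j.
move=> nE; apply: contrapT => nU; apply: nE => f [j _ Ef].
apply: contrapT => nPf; apply: nU; exists j => //.
by rewrite UE => /(_ _ Ef).
Qed.

HB.instance Definition _ := isOpenTopological.Build (Spec A)
  zariski_openT zariski_openI zariski_open_bigU.

Lemma zariski_openE : (open : set_system (Spec A)) = zariski_open.
Proof. by []. Qed.

End Zariski.

Definition PA_property (A : comPzRingType) (S : set (Spec A)) : Prop :=
  forall I : set A, is_ideal I ->
    I `<=` \bigcup_(P in S) (P : set A) -> exists2 P, S P & I `<=` P.

Definition PA_property_fg (A : comPzRingType) (S : set (Spec A)) : Prop :=
  forall I : set A, is_ideal I -> finitely_generated I ->
    I `<=` \bigcup_(P in S) (P : set A) -> exists2 P, S P & I `<=` P.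

Section ContinuousRing.
Variables (X : topologicalType) (R : realType).
Local Notation C := (continuousType X R).
Implicit Types f g h : C.

Lemma ctsD f g : continuous (f \+ g).
Proof. by move=> x; apply: cvgD; apply: cts_fun. Qed.

Lemma ctsN f : continuous (\- f).
Proof. by move=> x; apply: cvgN; apply: cts_fun. Qed.

Lemma ctsM f g : continuous (f \* g).
Proof. by move=> x; apply: cvgM; apply: cts_fun. Qed.

Definition cts_zero : C := cst 0.
Definition cts_one : C := cst 1.
Definition cts_add f g : C := mkcts (@ctsD f g).
Definition cts_opp f : C := mkcts (@ctsN f).
Definition cts_mul f g : C := mkcts (@ctsM f g).

Lemma cts_addA : associative cts_add.
Proof. by move=> f g h; apply/continuousEP => x; apply: addrA. Qed.

Lemma cts_addC : commutative cts_add.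
Proof. by move=> f g; apply/continuousEP => x; apply: addrC. Qed.

Lemma cts_add0 : left_id cts_zero cts_add.
Proof. by move=> f; apply/continuousEP => x; apply: add0r. Qed.

Lemma cts_addN : left_inverse cts_zero cts_opp cts_add.
Proof. by move=> f; apply/continuousEP => x; apply: addNr. Qed.

HB.instance Definition _ :=
  GRing.isZmodule.Build C cts_addA cts_addC cts_add0 cts_addN.

Lemma cts_mulA : associative cts_mul.
Proof. by move=> f g h; apply/continuousEP => x; apply: mulrA. Qed.

Lemma cts_mulC : commutative cts_mul.
Proof. by move=> f g; apply/continuousEP => x; apply: mulrC. Qed.

Lemma cts_mul1 : left_id cts_one cts_mul.
Proof. by move=> f; apply/continuousEP => x; apply: mul1r. Qed.

Lemma cts_mulD : left_distributive cts_mul +%R.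
Proof. by move=> f g h; apply/continuousEP => x; apply: mulrDl. Qed.

HB.instance Definition _ :=
  GRing.Zmodule_isComPzRing.Build C cts_mulA cts_mulC cts_mul1 cts_mulD.

Definition point_ideal (x : X) : set C := [set f | f x = 0].

Lemma point_ideal_prime x : is_prime_ideal (point_ideal x).
Proof.
split; [split| |].
- by [].
- by move=> f g f0 g0; change (f x + g x = 0); rewrite f0 g0 addr0.
- by move=> a f f0; change (a x * f x = 0); rewrite f0 mulr0.
- by change (~ (1 = 0 :> R)); apply/eqP; rewrite oner_eq0.
- move=> f g fg0; have /eqP : f x * g x = 0 by exact: fg0.
  by rewrite mulf_eq0 => /orP[] /eqP; [left|right].
Qed.

Definition point_spec (x : X) : Spec C := MkSpec (point_ideal_prime x).

End ContinuousRing.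

(* Main.v *)
Require Import Defs.
From mathcomp Require Import all_boot all_order all_algebra.
From mathcomp Require Import finmap.
From mathcomp Require Import all_classical all_reals all_analysis.
Set Implicit Arguments.
Unset Strict Implicit.
Import Order.TTheory GRing.Theory Num.Theory.
Import numFieldNormedType.Exports.
Local Open Scope classical_set_scope.
Local Open Scope ring_scope.

(** Every finitely generated ideal [(f_1, ..., f_n)] of [C(X)] has the
    same prime overideals as one of its elements, [g = \sum_i f_i ^ 2].
    Indeed a prime ideal of [C(X)] is absolutely convex
    ([prime_absolutely_convex]): if [|f| <= |g|] then [f ^ 2 / g], extended by
    zero on the zeros of [g], is continuous, so [g] divides [f ^ 2]. As
    [f_i ^ 2 <= g], a prime that contains [g] contains every [f_i]. Prime
    avoidance for finitely generated ideals is then immediate: a member of [S]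
    containing [g] contains the ideal.

    The equivalence with compactness holds for any ring in which [S] avoids
    finitely generated ideals. If [S] is compact and no member of [S] contains
    [I], then the basic open sets [D(f)], [f] in [I], cover [S]; finitely many
    of them suffice, which yields a finitely generated subideal of [I]
    contained in no member of [S], yet covered by [S]. Conversely, given an
    open cover of [S], the elements [f] for which [D(f)] lies in a finite
    union of the cover form an ideal contained in no member of [S]; prime
    avoidance provides [f] in it that lies in no member of [S], so that
    [S `<=` D(f)] is covered by finitely many of the open sets.

    Finally [a |-> M_a] is continuous for the Zariski topology, so it maps
    compact sets to compact sets; a closed subset of a compact space is one. *)

(** * Ideals and finite generation *)

Section Ideals.
Variable A : comPzRingType.
Implicit Types (I : set A).

Lemma ideal_sum I n (h : 'I_n -> A) :
  is_ideal I -> (forall i, I (h i)) -> I (\sum_(i < n) h i).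
Proof. by move=> [I0 ID _] Ih; apply: (big_ind I). Qed.

Definition ideal_span n (g : 'I_n -> A) : set A :=
  [set f | exists a : 'I_n -> A, f = \sum_(i < n) a i * g i].

Lemma ideal_span_ideal n (g : 'I_n -> A) : is_ideal (ideal_span g).
Proof.
split.
- by exists (fun=> 0); rewrite big1// => i _; rewrite mul0r.
- move=> _ _ [a ->] [b ->]; exists (fun i => a i + b i).
  by rewrite -big_split; apply: eq_bigr => i _; rewrite mulrDl.
- move=> c _ [a ->]; exists (fun i => c * a i).
  by rewrite big_distrr; apply: eq_bigr => i _; rewrite /= mulrA.
Qed.

Lemma mem_ideal_span n (g : 'I_n -> A) i : ideal_span g (g i).
Proof.
exists (fun j => (j == i)%:R).
rewrite (bigD1 i)//= eqxx mul1r big1 ?addr0// => j /negPf->.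
by rewrite mul0r.
Qed.

Lemma ideal_span_sub n (g : 'I_n -> A) I :
  is_ideal I -> (forall i, I (g i)) -> ideal_span g `<=` I.
Proof.
move=> idI Ig _ [a ->]; apply: ideal_sum => // i.
by case: idI => _ _; apply; apply: Ig.
Qed.

End Ideals.

(** * Prime avoidance and compactness over an arbitrary ring *)

Section Compactness.
Variable A : comPzRingType.
Implicit Types (S : set (Spec A)).

(** The ideal used here consists of the [f] for which [D(f)] lies in the union
    of finitely many members of the cover. Describing it by primes,
    rather than as a sum of the ideals that define the open sets, makes it an
    ideal at once and yields the finite subcover without writing [f] as a
    finite combination of generators. *)
Lemma PA_property_cover_compact S : PA_property S -> cover_compact S.
Proof.
move=> PA J D U Uopen Scov.
pose I : set A := [set f | exists2 D' : {fset J}, {subset D' <= D} &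
  forall P : Spec A, ~ cover [set` D'] U P -> prime_set P f].
have idI : is_ideal I.
  split.
  - exists fset0 => // P _; by have [[]] := prime_setP P.
  - move=> f g [Df sDf fP] [Dg sDg gP]; exists (Df `|` Dg)%fset.
      by move=> j; rewrite inE => /orP[/sDf|/sDg].
    move=> P nUP; have [[_ addP _] _ _] := prime_setP P.
    apply: addP; [apply: fP|apply: gP] => -[j /= jD UjP]; apply: nUP;
      by exists j; rewrite //= inE jD ?orbT.
  - move=> a f [Df sDf fP]; exists Df => // P /fP Pf.
    by have [[_ _ mulP] _ _] := prime_setP P; apply: mulP.
have nIS P : S P -> ~ I `<=` P.
  move=> SP IP; have [j Dj] := Scov P SP.
  have : zariski_open (U j) := Uopen j Dj.
  move=> [E UE]; rewrite UE; apply => f Ef; apply: IP.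
  exists [fset j]%fset; first by move=> k; rewrite inE => /eqP->; rewrite inE.
  move=> Q nUQ; apply: contrapT => nQf; apply: nUQ.
  by exists j; [rewrite /= inE|rewrite UE => /(_ f Ef)].
have : ~ I `<=` \bigcup_(P in S) (P : set A).
  by move=> IS; have [P SP IP] := PA I idI IS; exact: nIS SP IP.
move=> /existsNP[f /not_implyP[[D' sD' fP] nfS]]; exists D' => // P SP.
by apply: contrapT => nUP; apply: nfS; exists P => //; apply: fP.
Qed.

Lemma cover_compact_PA_property S :
  PA_property_fg S -> cover_compact S -> PA_property S.
Proof.
move=> PAfg Sco I idI IS; apply: contrapT => nI.
pose U (f : A) : set (Spec A) := ~` zariski_closed [set f].
have Uopen f : I f -> open (U f) by move=> _; exists [set f].
have Scov : S `<=` cover I U.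
  move=> P SP; have : ~ I `<=` P by move=> IP; apply: nI; exists P.
  move=> /existsNP[f /not_implyP[If nPf]]; exists f => // fP.
  by apply: nPf; apply: fP.
have [D' sD' SD'] := Sco A I U Uopen Scov.
pose g (i : 'I_(size D')) : A := nth 0 D' i.
have Ig i : I (g i) by apply: set_mem; apply: sD'; rewrite mem_nth.
have gS : ideal_span g `<=` \bigcup_(P in S) (P : set A).
  exact: subset_trans (ideal_span_sub idI Ig) IS.
have fg_g : finitely_generated (ideal_span g) by exists (size D'), g.
have [P SP gP] := PAfg _ (ideal_span_ideal g) fg_g gS.
have [f /= fD' nPf] := SD' P SP; apply: nPf => _ ->; apply: gP.
have lt_f : (index f D' < size D')%N by rewrite index_mem.
have -> : f = g (Ordinal lt_f) by rewrite /g nth_index.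
exact: mem_ideal_span.
Qed.

End Compactness.

(** * Compactness by open covers *)

Section CoverCompact.
Variables T U : topologicalType.

(** Adding the complement of [A] to each set of the cover, instead of as one
    more set, keeps the index type; the result covers [B] only if there is at
    least one index, whence the separate case of an empty [A]. *)
Lemma closed_cover_compact (A B : set T) :
  closed A -> A `<=` B -> cover_compact B -> cover_compact A.
Proof.
move=> Acl AB Bco J D F Fopen Acov.
have [A0|/set0P[x0 Ax0]] := eqVneq A set0.
  by exists fset0 => // x; rewrite A0.
have [j0 Dj0 _] := Acov x0 Ax0.
have [|x Bx|D' sD' BD'] := Bco J D (fun j => F j `|` ~` A).
- by move=> j Dj; apply: openU; [apply: Fopen|rewrite openC].
- have [Ax|nAx] := pselect (A x); last by exists j0 => //; right.
  by have [j Dj Fjx] := Acov x Ax; exists j => //; left.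
- by exists D' => // x Ax; have [j jD' [Fjx|]] := BD' x (AB x Ax); [exists j|].
Qed.

Lemma image_cover_compact (f : T -> U) (A : set T) :
  continuous f -> cover_compact A -> cover_compact (f @` A).
Proof.
move=> /continuousP fC Aco J D F Fopen fAcov.
have [j Dj|x Ax|D' sD' AD'] := Aco J D (fun j => f @^-1` F j).
- exact/fC/Fopen.
- by apply: fAcov; exists x.
- by exists D' => // _ [x Ax <-]; apply: AD'.
Qed.

End CoverCompact.

(** * Rings of continuous functions *)

Section ContinuousFunctions.
Variables (R : realType) (X : topologicalType).
Local Notation C := (continuousType X R).
Implicit Types (f g h : C) (S : set (Spec C)).

(** The field inverse satisfies [0^-1 = 0], so this formula already is the
    extension by zero. At a zero of [g] the quotient is squeezed by
    [|f ^ 2 / g| <= |f|], and [f] vanishes there. *)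
Lemma continuous_sqr_div f g :
  (forall x, `|f x| <= `|g x|) -> continuous (fun x => f x * f x / g x).
Proof.
move=> fg x; have [gx0|gx_neq0] := eqVneq (g x) 0; last first.
  apply: cvgM; last by apply: cvgV => //; apply: cts_fun.
  by apply: cvgM; apply: cts_fun.
have fx0 : f x = 0.
  by apply/eqP; rewrite -normr_le0 (le_trans (fg x))// gx0 normr0.
apply/cvgrPdist_lt => e e0 /=; rewrite fx0 !mul0r.
have /cvgrPdist_lt /(_ e e0) := @cts_fun _ _ f x.
apply: filterS => y; rewrite fx0 !sub0r !normrN; apply: le_lt_trans.
have [gy0|gy_neq0] := eqVneq (g y) 0; first by rewrite gy0 invr0 mulr0 normr0.
by rewrite !normrM normfV ler_pdivrMr ?normr_gt0// ler_wpM2l.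
Qed.

Lemma prime_absolutely_convex (P : Spec C) f g :
  (forall x, `|f x| <= `|g x|) -> prime_set P g -> prime_set P f.
Proof.
move=> fg Pg; have [[_ _ mulP] _ prP] := prime_setP P.
pose h : C := mkcts (continuous_sqr_div fg).
have ffE : f * f = h * g.
  apply/continuousEP => x; change (f x * f x = f x * f x / g x * g x).
  have [gx0|gx_neq0] := eqVneq (g x) 0; last by rewrite divfK.
  have := fg x; rewrite gx0 normr0 normr_le0 => /eqP->.
  by rewrite !mul0r.
have : prime_set P (f * f) by rewrite ffE; apply: mulP.
by case/prP.
Qed.

Lemma cts_sumE n (h : 'I_n -> C) x : (\sum_(i < n) h i) x = \sum_(i < n) h i x.
Proof. exact: (big_morph (fun k : C => k x)). Qed.

Lemma prime_sum_sqr (P : Spec C) n (f : 'I_n -> C) :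
  prime_set P (\sum_(i < n) f i * f i) -> forall i, prime_set P (f i).
Proof.
move=> Psum i; have [_ _ prP] := prime_setP P.
suff /prP[] : prime_set P (f i * f i) by [].
apply: prime_absolutely_convex Psum => x.
have sqrE j : (f j * f j) x = f j x ^+ 2 by rewrite expr2.
rewrite cts_sumE sqrE (eq_bigr _ (fun j _ => sqrE j)).
rewrite !ger0_norm ?sqr_ge0 ?sumr_ge0// => [|j _]; last exact: sqr_ge0.
by rewrite (bigD1 i)//= lerDl sumr_ge0// => j _; apply: sqr_ge0.
Qed.

Lemma cts_PA_property_fg S : PA_property_fg S.
Proof.
move=> I idI [n [f IE]] IS.
have If i : I (f i) by rewrite IE; apply: mem_ideal_span.
have Isum : I (\sum_(i < n) f i * f i).
  by apply: ideal_sum => // i; case: idI => _ _; apply.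
have [P SP Psum] := IS _ Isum; exists P => //.
have [idP _ _] := prime_setP P.
by rewrite IE; apply: ideal_span_sub idP _; apply: prime_sum_sqr.
Qed.

(** The preimage of the closed set defined by [E] is the set of common zeros of
    the functions in [E]. *)
Lemma point_spec_continuous : continuous (point_spec R : X -> Spec C).
Proof.
apply/continuousP => U; rewrite zariski_openE => -[E ->].
rewrite preimage_setC openC.
rewrite [X in closed X](_ : _ = \bigcap_(f in E) f @^-1` [set 0]);
  last by apply/seteqP; split.
apply: closed_bigI => f _; apply: preimage_closed; last exact: closed_eq.
by move=> x _; apply: cts_fun.
Qed.

End ContinuousFunctions.

Theorem corollary2p17 (R : realType) (X : topologicalType) :
  (forall S : set (Spec (continuousType X R)),
     PA_property_fg S /\ (PA_property S <-> cover_compact S)) /\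
  (forall A : set X,
     (cover_compact [set: X] /\ closed A) \/ cover_compact A ->
     PA_property [set point_spec R a | a in A]).
Proof.
split=> [S|A Aco].
  split; first exact: cts_PA_property_fg.
  split; first exact: PA_property_cover_compact.
  exact/cover_compact_PA_property/cts_PA_property_fg.
apply: cover_compact_PA_property; first exact: cts_PA_property_fg.
apply: image_cover_compact; first exact: point_spec_continuous.
by case: Aco => // -[Xco Acl]; apply: closed_cover_compact Xco.
Qed.
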